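(* Let $a,b\in\mathbb{C}$ and let $\{P_n(x)\}_{n=0}^{\infty}$ be the polynomial sequence generated by $$\sum_{n=0}^{\infty}P_n(x)\frac{z^n}{n!}=e^{xz+az^2+bz^4}.$$ Then for every $n\ge 4$, $$P_n(x)=xP_{n-1}(x)+2a\binom{n-1}{1}P_{n-2}(x)+24b\binom{n-1}{3}P_{n-4}(x),$$ where $P_0(x)=1$, $P_1(x)=x$, $P_2(x)=2a+x^2$, and $P_3(x)=6ax+x^3$.
   Context: The generating relation is an identity of formal power series in $z$: $P_n(x)/n!$ is the coefficient of $z^n$ in $e^{xz+az^2+bz^4}$. *)

(* Defs.v *)
From mathcomp Require Import all_boot all_order all_algebra.
From mathcomp Require Import reals complex.

Set Implicit Arguments.
Unset Strict Implicit.
Unset Printing Implicit Defensive.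

Import GRing.Theory.
Local Open Scope ring_scope.

(* A formal power series in z over A is its sequence of coefficients:
   [f n] is the coefficient of z^n. *)
Definition fps (A : Type) := nat -> A.

Section FormalPowerSeries.
Variable A : nzRingType.
Implicit Types f g : fps A.

(* c z^k *)
Definition fps_monom (c : A) (k : nat) : fps A :=
  fun n => if n == k then c else 0.

Definition fps_add f g : fps A := fun n => f n + g n.

Definition fps_mul f g : fps A :=
  fun n => \sum_(i < n.+1) f i * g (n - i)%N.

Definition fps_pow f (k : nat) : fps A := iter k (fps_mul f) (fps_monom 1 0).

Lemma fps_pow_eq0 f k n : f 0%N = 0 -> (n < k)%N -> fps_pow f k n = 0.
Proof.
move=> f0; elim: k n => [//|k IHk] n lt_nk.
rewrite /fps_pow iterS -/(fps_pow f k) /fps_mul big1 // => -[[|i] /= lt_in] _.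
  by rewrite f0 mul0r.
rewrite IHk ?mulr0 //; apply: leq_trans (lt_nk : (n <= k)%N).
by rewrite ltn_subrL /=; exact: leq_ltn_trans (leq0n i) (lt_in : (i < n)%N).
Qed.

End FormalPowerSeries.

(* exp f = \sum_(k >= 0) f^k / k! for a series f with zero constant term. By
   [fps_pow_eq0] the terms with k > n do not contribute to the coefficient of
   z^n, so the sum stops at k = n. Meaningful only when [f 0 = 0]. *)
Definition fps_exp (K : fieldType) (A : algType K) (f : fps A) : fps A :=
  fun n => \sum_(k < n.+1) (k`!%:R : K)^-1 *: fps_pow f k n.

(* The exponent x z + a z^2 + b z^4, as a series in z over K[x]. *)
Definition gen_exponent (K : fieldType) (a b : K) : fps {poly K} :=
  fps_add (fps_monom 'X 1) (fps_add (fps_monom a%:P 2) (fps_monom b%:P 4)).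

(* Main.v *)
Require Import Defs.
From mathcomp Require Import all_boot all_order all_algebra.
From mathcomp Require Import reals complex.
From mathcomp Require Import ring.

Import GRing.Theory.
Local Open Scope ring_scope.

(** The series [E = exp f] satisfies [E' = f' E]. For [f = x z + a z^2 + b z^4]
    only the coefficients of [1], [z] and [z^3] in [f'] are nonzero, so comparing
    coefficients gives a three-term recurrence, which also determines [P_0], ...,
    [P_3]. The derivative of [f^k] is computed on polynomial truncations of [f]. *)

(** A Cauchy product at index [n] reads its factors only at indices up to [n], so truncating [f] at
    any [N > n] is harmless. *)
Lemma fps_pow_coef (A : nzRingType) (f : fps A) N k n : (n < N)%N ->
  fps_pow f k n = ((\poly_(i < N) f i) ^+ k)`_n.
Proof.
elim: k n => [|k IHk] n ltnN.
  by rewrite expr0 coef1 /fps_pow /= /fps_monom; case: (n == 0)%N.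
rewrite exprS coefM /fps_pow iterS -/(fps_pow f k); apply: eq_bigr => i _.
have lein : (i <= n)%N by rewrite -ltnS.
by rewrite coef_poly (leq_ltn_trans lein) // IHk // (leq_ltn_trans (leq_subr _ _)).
Qed.

Lemma fps_pow_deriv (A : comNzRingType) (f : fps A) k n :
  fps_pow f k.+1 n.+1 *+ n.+1 =
    (\sum_(i < n.+1) (f i.+1 *+ i.+1) * fps_pow f k (n - i)%N) *+ k.+1.
Proof.
(* Truncating at [n.+2] keeps [f n.+1], the last coefficient that the derivative brings in. *)
rewrite (@fps_pow_coef _ f n.+2) // -coef_deriv deriv_exp /= coefMn coefM.
congr (_ *+ _); apply: eq_bigr => i _.
rewrite coef_deriv coef_poly ltnS ltn_ord.
by rewrite -fps_pow_coef // ltnS (leq_trans (leq_subr _ _)).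
Qed.

Section Exponential.
Variables (K : fieldType) (A : comAlgType K) (f : fps A).
Hypotheses (K_char0 : [pchar K] =i pred0) (f0 : f 0%N = 0).

(** Gives the coefficients up to [m] a common range of [k], so that sums can be exchanged; the added
    terms vanish because [f] has no constant term. *)
Lemma fps_exp_widen n m : (n <= m)%N ->
  fps_exp f n = \sum_(k < m.+1) (k`!%:R : K)^-1 *: fps_pow f k n.
Proof.
move=> lenm; rewrite /fps_exp.
rewrite (big_ord_widen m.+1 (fun k => (k`!%:R : K)^-1 *: fps_pow f k n)) //.
rewrite big_mkcond /=; apply: eq_bigr => k _; case: ltnP => // ltnk.
by rewrite fps_pow_eq0 // scaler0.
Qed.

Lemma natr_fact_neq0 n : (n`!%:R : K) != 0.
Proof. by rewrite ((pcharf0P _).1 K_char0) -lt0n fact_gt0. Qed.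

Lemma fps_exp_deriv n :
  fps_exp f n.+1 *+ n.+1 =
    \sum_(i < n.+1) (f i.+1 *+ i.+1) * fps_exp f (n - i)%N.
Proof.
(* The term [k = 0] is the constant series 1 and drops out. In the others, the factor [k.+1] from
   the power rule turns [1/(k.+1)!] into [1/k!]. *)
rewrite {1}/fps_exp big_ord_recl [fps_pow f ord0 n.+1]/= scaler0 add0r -sumrMnl.
transitivity (\sum_(k < n.+1) \sum_(i < n.+1)
    (k`!%:R : K)^-1 *: ((f i.+1 *+ i.+1) * fps_pow f k (n - i)%N)).
  apply: eq_bigr => k _; rewrite lift0 scalerMnr fps_pow_deriv -scaler_nat scalerA.
  rewrite factS natrM invfM mulrAC mulVf ?mul1r ?scaler_sumr //.
  by rewrite ((pcharf0P _).1 K_char0).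
rewrite exchange_big /=; apply: eq_bigr => i _.
rewrite (@fps_exp_widen _ n) ?leq_subr // mulr_sumr.
by apply: eq_bigr => k _; rewrite scalerAr.
Qed.

(** This is [E' = f' E] multiplied by [n!]: the weights come from [n! = 'C(n, i) * i! * (n - i)!]
    and [i.+1 * i! = i.+1!]. *)
Lemma egf_exp_rec (P : nat -> A)
  (hP : forall n, (n`!%:R : K)^-1 *: P n = fps_exp f n) n :
  P n.+1 = \sum_(i < n.+1) f i.+1 * P (n - i)%N *+ (i.+1`! * 'C(n, i)).
Proof.
have PE m : P m = fps_exp f m *+ m`!.
  by rewrite -hP -scaler_nat scalerA divff ?scale1r ?natr_fact_neq0.
rewrite PE factS mulrnA fps_exp_deriv -sumrMnl; apply: eq_bigr => i _.
have lein : (i <= n)%N by rewrite -ltnS.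
rewrite PE mulrnAl mulrnAr -!mulrnA; congr (_ *+ _).
by rewrite -(bin_fact lein) factS; ring.
Qed.

End Exponential.

Theorem theorem16 (R : realType) (a b : R[i]) (P : nat -> {poly R[i]})
  (hP : forall n : nat,
     (n`!%:R : R[i])^-1 *: P n = fps_exp (gen_exponent a b) n) :
  (forall n : nat, (4 <= n)%N ->
     P n = 'X * P (n - 1)%N
           + (2%:R * a * 'C(n - 1, 1)%:R) *: P (n - 2)%N
           + (24%:R * b * 'C(n - 1, 3)%:R) *: P (n - 4)%N)
  /\ [/\ P 0%N = 1,
         P 1%N = 'X,
         P 2%N = (2%:R * a)%:P + 'X^2
       & P 3%N = (6%:R * a) *: 'X + 'X^3].
Proof.
have f0 : gen_exponent a b 0 = 0 by rewrite /gen_exponent /fps_add /fps_monom /= !addr0.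
have f1 : gen_exponent a b 1 = 'X by rewrite /gen_exponent /fps_add /fps_monom /= !addr0.
have f2 : gen_exponent a b 2 = a%:P.
  by rewrite /gen_exponent /fps_add /fps_monom /= addr0 add0r.
have f3 : gen_exponent a b 3 = 0 by rewrite /gen_exponent /fps_add /fps_monom /= !addr0.
have f4 : gen_exponent a b 4 = b%:P.
  by rewrite /gen_exponent /fps_add /fps_monom /= !add0r.
have f5 i : gen_exponent a b i.+4.+1 = 0.
  by rewrite /gen_exponent /fps_add /fps_monom /= !addr0.
have rec := @egf_exp_rec _ _ _ (Num.Theory.pchar_num _) f0 P hP.
have P0 : P 0%N = 1.
  have := hP 0%N; rewrite fact0 invr1 scale1r => ->.
  by rewrite /fps_exp big_ord1 fact0 invr1 scale1r.
have P1 : P 1%N = 'X by rewrite rec big_ord1 /= f1 P0 mulr1.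
have P2 : P 2%N = (2%:R * a)%:P + 'X^2.
  rewrite rec !big_ord_recl big_ord0 /= /bump /= !add1n !subnn subn0 f1 f2 P0 P1.
  rewrite ?binn ?bin0 ?bin1 !factS fact0; rewrite polyCM polyC_natr; ring.
split; last first.
  split=> //.
  rewrite rec !big_ord_recl big_ord0 /= /bump /= !add1n subnn subn0 subSn // subnn.
  rewrite f1 f2 f3 P1 P2.
  rewrite ?binn ?bin0 ?bin1 !factS fact0 -mul_polyC !polyCM !polyC_natr; ring.
(* With [n = m.+4], only [i = 0, 1, 3] contribute, with weights [1!], [2!] and [4!]; the last two
   give the constants 2 and 24. *)
case=> [|[|[|[|m]]]] // _.
rewrite rec 4!big_ord_recl big1 => [|i _]; last first.
  by rewrite /= /bump /= !add1n f5 mul0r mul0rn.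
rewrite /= /bump /= !add1n f1 f2 f3 f4 bin0 !subSS !subn0.
rewrite !factS fact0 -!mul_polyC !polyCM !polyC_natr.
(* Once generalized, the binomials are atoms for [ring]; [c2] is multiplied by the zero coefficient
   of [z^3]. *)
move: 'C(m.+3, 1) 'C(m.+3, 2) 'C(m.+3, 3) => c1 c2 c3; ring.
Qed.
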